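(* Let $n\ge 1$ and let $\mathbf{\Pi}_{\mathrm{COP}},\mathbf{\Pi}_{\mathrm{NN}},\mathbf{\Pi}^\star\subset\mathbb{S}^{2n+1}$ be the sets of multipliers defined in the context. Then $\mathbf{\Pi}_{\mathrm{NN}}\subset\mathbf{\Pi}_{\mathrm{COP}}\subset\mathbf{\Pi}^\star$.
   Context: $\mathbb{S}^k$ is the set of real symmetric $k\times k$ matrices, $\mathbb{D}^n$ the set of real diagonal $n\times n$ matrices. The copositive cone is $\mathcal{COP}^k=\{P\in\mathbb{S}^k: x^TPx\ge 0\ \text{for all entrywise nonnegative } x\in\mathbb{R}^k\}$ and the nonnegative cone is $\mathcal{NN}^k=\{P\in\mathbb{S}^k: P_{ij}\ge 0\ \text{for all } i,j\}$. The ReLU map $\Phi:\mathbb{R}^n\to\mathbb{R}^n$ is $\Phi(q)=(\max(q_1,0),\dots,\max(q_n,0))^T$. $\mathbf{\Pi}^\star$ is the set of all $\Pi\in\mathbb{S}^{2n+1}$ such that $\begin{bmatrix}1\\ q\\ p\end{bmatrix}^T\Pi\begin{bmatrix}1\\ q\\ p\end{bmatrix}\ge 0$ for all $q,p\in\mathbb{R}^n$ with $p=\Phi(q)$. Let $$E=\begin{bmatrix}1&0_{1,n}&0_{1,n}\\ 0_{n,1}&-I_n&I_n\\ 0_{n,1}&0_{n,n}&I_n\end{bmatrix},\qquad \mathcal{J}(J)=\begin{bmatrix}0&0_{1,n}&0_{1,n}\\ 0_{n,1}&0_{n,n}&J\\ 0_{n,1}&J^T&0_{n,n}\end{bmatrix}.$$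 Then $$\mathbf{\Pi}_{\mathrm{COP}}=\{E^T(Q+\mathcal{J}(J))E:\ J\in\mathbb{D}^n,\ Q\in\mathcal{COP}^{2n+1}\},$$ $$\mathbf{\Pi}_{\mathrm{NN}}=\{E^T(Q+\mathcal{J}(J))E:\ J\in\mathbb{D}^n,\ Q\in\mathcal{NN}^{2n+1}\}.$$ Inclusions $\subset$ are not necessarily strict. *)

(* Defs.v *)
From mathcomp Require Import all_boot all_order all_algebra.
From mathcomp Require Import classical_sets reals.

Set Implicit Arguments.
Unset Strict Implicit.
Unset Printing Implicit Defensive.

Import Order.TTheory GRing.Theory Num.Theory.
Local Open Scope classical_set_scope.
Local Open Scope ring_scope.

(* The dimension 2n+1 is written 1 + (n + n), so that block matrices and
   stacked vectors typecheck without casts. *)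

Definition sym_mx (R : realType) (k : nat) : set 'M[R]_k :=
  [set P | P^T = P].
Arguments sym_mx : clear implicits.

Definition diagonal_mx (R : realType) (n : nat) : set 'M[R]_n :=
  [set J | is_diag_mx J].
Arguments diagonal_mx : clear implicits.

Definition quad_form (R : realType) (k : nat) (P : 'M[R]_k) (x : 'cV[R]_k) : R :=
  (x^T *m P *m x) 0 0.

Definition COP (R : realType) (k : nat) : set 'M[R]_k :=
  [set P | sym_mx R k P /\
     forall x : 'cV[R]_k, (forall i, 0 <= x i 0) -> 0 <= quad_form P x].
Arguments COP : clear implicits.

Definition NN (R : realType) (k : nat) : set 'M[R]_k :=
  [set P | sym_mx R k P /\ forall i j, 0 <= P i j].
Arguments NN : clear implicits.

Definition relu (R : realType) (n : nat) (q : 'cV[R]_n) : 'cV[R]_n :=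
  \col_i Num.max (q i 0) 0.

Definition stack1 (R : realType) (n : nat) (q p : 'cV[R]_n) :
    'cV[R]_(1 + (n + n)) :=
  col_mx (const_mx 1) (col_mx q p).

Definition Pi_star (R : realType) (n : nat) : set 'M[R]_(1 + (n + n)) :=
  [set P | sym_mx R (1 + (n + n)) P /\
     forall q p : 'cV[R]_n, p = relu q -> 0 <= quad_form P (stack1 q p)].
Arguments Pi_star : clear implicits.

Definition E_mx (R : realType) (n : nat) : 'M[R]_(1 + (n + n)) :=
  block_mx 1%:M 0
           0    (block_mx (- 1%:M) 1%:M
                          0        1%:M).

Definition J_mx (R : realType) (n : nat) (J : 'M[R]_n) : 'M[R]_(1 + (n + n)) :=
  block_mx 0 0
           0 (block_mx 0   J
                       J^T 0).

Definition Pi_COP (R : realType) (n : nat) : set 'M[R]_(1 + (n + n)) :=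
  [set (E_mx R n)^T *m (Q + J_mx J) *m E_mx R n
    | J in diagonal_mx R n & Q in COP R (1 + (n + n))].
Arguments Pi_COP : clear implicits.

Definition Pi_NN (R : realType) (n : nat) : set 'M[R]_(1 + (n + n)) :=
  [set (E_mx R n)^T *m (Q + J_mx J) *m E_mx R n
    | J in diagonal_mx R n & Q in NN R (1 + (n + n))].
Arguments Pi_NN : clear implicits.

(* Main.v *)
(* The substitution E [1; q; p] = [1; p - q; p] sends the graph of ReLU into
   nonnegative vectors satisfying the complementarity (p - q)_i p_i = 0:
   copositivity of Q handles the first property, and the second one kills the
   quadratic form of J_mx J when J is diagonal. *)
Require Import Defs.
From mathcomp Require Import all_boot all_order all_algebra.
From mathcomp Require Import classical_sets reals.

Local Open Scope classical_set_scope.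

Import Order.TTheory GRing.Theory Num.Theory.
Local Open Scope ring_scope.

Lemma quad_form_congr (R : realType) (k : nat) (P E : 'M[R]_k) (x : 'cV[R]_k) :
  quad_form (E^T *m P *m E) x = quad_form P (E *m x).
Proof. by rewrite /quad_form trmx_mul !mulmxA. Qed.

Lemma quad_formD (R : realType) (k : nat) (P Q : 'M[R]_k) (x : 'cV[R]_k) :
  quad_form (P + Q) x = quad_form P x + quad_form Q x.
Proof. by rewrite /quad_form mulmxDr mulmxDl mxE. Qed.

(** At an entrywise nonnegative [x] the form is a sum of products [x_i P_ij x_j] of nonnegative
    factors. *)
Lemma NN_subset_COP (R : realType) (k : nat) : NN R k `<=` COP R k.
Proof.
move=> P [Psym P_ge0]; split=> // x x_ge0.
rewrite /quad_form mxE; apply: sumr_ge0 => j _; rewrite mulr_ge0 //.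
by rewrite mxE; apply: sumr_ge0 => i _; rewrite mxE mulr_ge0.
Qed.

Lemma J_mx_sym (R : realType) (n : nat) (J : 'M[R]_n) : (J_mx J)^T = J_mx J.
Proof. by rewrite /J_mx !tr_block_mx !trmx0 trmxK. Qed.

Lemma E_mx_stack1 (R : realType) (n : nat) (q p : 'cV[R]_n) :
  E_mx R n *m stack1 q p = stack1 (p - q) p.
Proof.
rewrite /E_mx /stack1 !mul_block_col !mul0mx !mul1mx mulNmx mul1mx addr0 !add0r.
by rewrite addrC.
Qed.

Lemma stack1_ge0 (R : realType) (n : nat) (a b : 'cV[R]_n) :
  (forall i, 0 <= a i 0) -> (forall i, 0 <= b i 0) ->
  forall i, 0 <= stack1 a b i 0.
Proof.
move=> a_ge0 b_ge0 i; rewrite /stack1 mxE; case: (split i) => [k|k].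
  by rewrite mxE.
by rewrite mxE; case: (split k).
Qed.

(** The form expands to [a^T J b + b^T J^T a]; for diagonal [J] both terms equal the sum of
    [J_ii a_i b_i], whose summands all vanish. *)
Lemma quad_form_J_mx_eq0 (R : realType) (n : nat) (J : 'M[R]_n)
    (a b : 'cV[R]_n) :
  is_diag_mx J -> (forall i, a i 0 * b i 0 = 0) ->
  quad_form (J_mx J) (stack1 a b) = 0.
Proof.
move=> /is_diag_mxP Jdiag ab0.
have aJb0 : a^T *m J *m b = 0.
  apply/matrixP => i j; rewrite !ord1 !mxE big1 // => l _; rewrite mxE.
  rewrite (bigD1 l) //= big1 ?addr0 => [|m ml].
    by rewrite mxE mulrAC ab0 mul0r.
  by rewrite Jdiag ?mulr0.
(* This 1 x 1 matrix is the transpose of the previous one. *)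
have bJa0 : b^T *m J^T *m a = 0.
  by apply: trmx_inj; rewrite !trmx_mul !trmxK mulmxA aJb0 trmx0.
rewrite /quad_form /stack1 /J_mx !tr_col_mx -mulmxA !mul_block_col !mul_row_col.
by rewrite !mul0mx !add0r !addr0 mul_row_col mulmx0 add0r !mulmxA aJb0 bJa0 addr0 mxE.
Qed.

Lemma relu_ge0 (R : realType) (n : nat) (q : 'cV[R]_n) i : 0 <= relu q i 0.
Proof. by rewrite mxE le_max lexx orbT. Qed.

Lemma relu_sub_ge0 (R : realType) (n : nat) (q : 'cV[R]_n) i :
  0 <= (relu q - q) i 0.
Proof. by rewrite !mxE subr_ge0 le_max lexx. Qed.

(** Each entry of [relu q] is either 0, killing the second factor, or [q_i], killing the first. *)
Lemma relu_complementarity (R : realType) (n : nat) (q : 'cV[R]_n) i :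
  (relu q - q) i 0 * relu q i 0 = 0.
Proof. by rewrite !mxE; case: leP => _; rewrite ?mulr0 // subrr mul0r. Qed.

Theorem theorem2 (R : realType) (n : nat) (n_ge1 : (1 <= n)%N) :
  Pi_NN R n `<=` Pi_COP R n /\ Pi_COP R n `<=` Pi_star R n.
Proof.
split.
  by move=> _ [J Jdiag [Q /NN_subset_COP QCOP <-]]; exists J => //; exists Q.
move=> _ [J Jdiag [Q [Qsym Qcop] <-]]; split.
  (* Congruence by [E_mx] preserves the symmetry of [Q + J_mx J]. *)
  by rewrite /sym_mx /= !trmx_mul trmxK linearD /= Qsym J_mx_sym mulmxA.
(* Moving [E_mx] onto the vector leaves the forms of [Q] and [J_mx J] to be evaluated at
   [stack1 (relu q - q) (relu q)]. *)
move=> q _ ->; rewrite quad_form_congr E_mx_stack1 quad_formD.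
rewrite quad_form_J_mx_eq0 ?addr0 //; last exact: relu_complementarity.
by apply: Qcop; apply: stack1_ge0; [exact: relu_sub_ge0 | exact: relu_ge0].
Qed.
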